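(* Let $\mathcal{L}=\{(f_j,g_j,y_j^{*})\}_{j=1}^{J}$ be any task list in dimension $n$. Then: (i) The values realised by arbitrary linear responses fill the subspace $\{y(X):X\in\mathbb{R}^{n\times n}\}=(\mathcal{A}^{0}_{\mathcal{L}})^{\perp}$, of dimension $\dim\mathcal{M}$. (ii) The values realised by symmetric responses fill exactly $\{y(X):X=X^{T}\}=\mathcal{S}_{\mathcal{L}}$, of dimension $\dim\mathcal{M}^{s}$ and of codimension $\dim\mathcal{A}^{1}_{\mathcal{L}}=\delta_{\mathcal{L}}$ inside $(\mathcal{A}^{0}_{\mathcal{L}})^{\perp}$; so $y(C)\in\mathcal{S}_{\mathcal{L}}$ for every symmetric $C$ (invertible or not, positive definite or not), and the linear relations $\sum_j\lambda_jy_j=0$ forced among the task values of symmetric responses are exactly those with $\lambda\in\mathcal{A}_{\mathcal{L}}$. (iii) $\delta_{\mathcal{L}}=\dim(\mathcal{M}\cap\operatorname{Skew}(n))$. (iv) Over symmetric invertible $C$ the values $y(C)$ form an open dense subset of $\mathcal{S}_{\mathcal{L}}$, and over $C\succ0$ a non-empty open convex cone in $\mathcal{S}_{\mathcal{L}}$ (openness relative to $\mathcal{S}_{\mathcal{L}}$). Both are in general proper subsets of $\mathcal{S}_{\mathcal{L}}$ (there are task lists for which they are proper), the second need not be closed, and both span $\mathcal{S}_{\mathcal{L}}$, so neither satisfies a linear relation that $\mathcal{S}_{\mathcal{L}}$ does not. (v) Let $n=n_{\mathrm{free}}$ and write $y(k)=y(K_{ff}(k)^{-1})$ for a network. At every admissible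 $k$ with $K_{ff}=K_{ff}^{T}$, $$\operatorname{rank}\frac{\partial y}{\partial k}\;\le\;\min\bigl(n_b,\ \dim\mathcal{M}-\delta_{\mathcal{L}}\bigr),$$ while differentiating in $(k,a)$ without assuming symmetry one has $\operatorname{rank}\,\partial y/\partial(k,a)\le\min(2n_b,\dim\mathcal{M})$.
   Context: Task list: a finite family $\mathcal{L}=\{(f_j,g_j,y^{*}_j)\}_{j=1}^{J}$ with $f_j,g_j\in\mathbb{R}^{n}$, $y_j^{*}\in\mathbb{R}$. Put $\mathsf{M}_j=g_jf_j^{T}\in\mathbb{R}^{n\times n}$ and, for $X\in\mathbb{R}^{n\times n}$, $y(X)=(y_1(X),\dots,y_J(X))$ with $y_j(X)=g_j^{T}Xf_j=\langle\mathsf{M}_j,X\rangle$, $\langle A,B\rangle=\operatorname{tr}(A^{T}B)$. With $\operatorname{sym}A=\tfrac12(A+A^{T})$: $\mathcal{M}=\operatorname{span}\{\mathsf{M}_j\}$, $\mathcal{M}^{s}=\operatorname{span}\{\operatorname{sym}\mathsf{M}_j\}$, and the deficit is $\delta_{\mathcal{L}}=\dim\mathcal{M}-\dim\mathcal{M}^{s}$. $\operatorname{Skew}(n)$ is the space of antisymmetric $n\times n$ matrices. For $\lambda\in\mathbb{R}^{J}$, $\mathsf{M}(\lambda)=\sum_j\lambda_j\mathsf{M}_j$. $\mathcal{A}^{0}_{\mathcal{L}}=\{\lambda:\mathsf{M}(\lambda)=0\}$, $\mathcal{A}_{\mathcal{L}}=\{\lambda:\operatorname{sym}\mathsf{M}(\lambda)=0\}$,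 $\mathcal{A}^{1}_{\mathcal{L}}=\mathcal{A}_{\mathcal{L}}\cap(\mathcal{A}^{0}_{\mathcal{L}})^{\perp}$, $\mathcal{S}_{\mathcal{L}}=\mathcal{A}_{\mathcal{L}}^{\perp}\subseteq\mathbb{R}^{J}$. Network (for (v)): $N$ point nodes at positions $x_i\in\mathbb{R}^2$ are joined by $n_b$ bonds. For a bond $b=(i,j)$ of length $L_b=|x_j-x_i|>0$ let $\hat n_b=(x_j-x_i)/L_b$ and let $\hat t_b$ be $\hat n_b$ rotated by $+90^\circ$. The vector $q_b\in\mathbb{R}^{2N}$ carries $-\hat n_b$ at node $i$, $+\hat n_b$ at node $j$, zeros elsewhere; $s_b$ is the same with $\hat t_b$. For stiffnesses $k=(k_b)$ and odd couplings $a=(a_b)\in\mathbb{R}^{n_b}$, $K=\sum_b(k_bq_b+a_bs_b)q_b^{T}$. Three degrees of freedom are pinned to remove the planar rigid-body modes and $K_{ff}$ is the restriction of $K$ to the remaining $n_{\mathrm{free}}=2N-3$ free ones. $k$ is admissible if all $k_b>0$ and $K_{ff}$ is invertible; $\partial y/\partial k$ is taken at fixed $a$. *)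

(* Defs.v *)
From HB Require Import structures.
From mathcomp Require Import all_boot all_order all_algebra.
From mathcomp Require Import all_classical all_reals all_analysis.

Set Implicit Arguments.
Unset Strict Implicit.
Unset Printing Implicit Defensive.

Import Order.TTheory GRing.Theory Num.Theory.
Import numFieldNormedType.Exports.

Local Open Scope classical_set_scope.
Local Open Scope ring_scope.

(* On row vectors this is the Euclidean dot product, see mxdot_rV. *)
Definition mxdot (R : fieldType) (m n : nat) (A B : 'M[R]_(m, n)) : R :=
  \tr (A^T *m B).

Lemma mxdotE (R : fieldType) (m n : nat) (A B : 'M[R]_(m, n)) :
  mxdot A B = \sum_i \sum_j A i j * B i j.
Proof.
rewrite /mxdot /mxtrace exchange_big /=; apply: eq_bigr => j _.
by rewrite mxE; apply: eq_bigr => i _; rewrite mxE.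
Qed.

Lemma mxdot_rV (R : fieldType) (n : nat) (u v : 'rV[R]_n) :
  mxdot u v = \sum_j u 0 j * v 0 j.
Proof. by rewrite mxdotE big_ord1. Qed.

Lemma mxdot_is_bilinear (R : fieldType) (m n : nat) :
  bilinear_for (GRing.Scale.Law.clone _ _ *%R _)
    (GRing.Scale.Law.clone _ _ (idfun \; *%R) _) (@mxdot R m n).
Proof.
split=> [B|A] a X Y /=.
- by rewrite /mxdot linearD linearZ /= mulmxDl -scalemxAl linearD linearZ.
- by rewrite /mxdot mulmxDr -scalemxAr linearD linearZ.
Qed.

HB.instance Definition _ (R : fieldType) (m n : nat) :=
  bilinear_isBilinear.Build R 'M[R]_(m, n) 'M[R]_(m, n) R _ _ (@mxdot R m n)
    (mxdot_is_bilinear R m n).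

Lemma mxdot_is_hermitian (R : fieldType) (m n : nat) (A B : 'M[R]_(m, n)) :
  mxdot A B = (-1) ^+ false * idfun (mxdot B A).
Proof.
by rewrite mul1r /= /mxdot -mxtrace_tr trmx_mul trmxK.
Qed.

HB.instance Definition _ (R : fieldType) (m n : nat) :=
  isHermitianSesquilinear.Build R 'M[R]_(m, n) false idfun (@mxdot R m n)
    (@mxdot_is_hermitian R m n).

Definition orthc (R : fieldType) (n : nat) (U : {vspace 'rV[R]_n}) :
  {vspace 'rV[R]_n} := orthov (@mxdot R 1 n) U.

Lemma orthcP (R : fieldType) (n : nat) (U : {vspace 'rV[R]_n}) (u : 'rV[R]_n) :
  reflect (forall v, v \in U -> \sum_j u 0 j * v 0 j = 0) (u \in orthc U).
Proof.
rewrite /orthc; apply: (iffP mem_orthovP) => uU v vU.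
- by rewrite -mxdot_rV; exact: uU.
- by have := uU v vU; rewrite -mxdot_rV.
Qed.

Definition symm (R : fieldType) (n : nat) (A : 'M[R]_n) : 'M[R]_n :=
  2^-1 *: (A + A^T).

Lemma symm_is_linear (R : fieldType) (n : nat) : linear (@symm R n).
Proof.
move=> a A B; rewrite /symm linearP /= addrACA -scalerDr.
by rewrite [LHS]scalerDr !scalerA mulrC.
Qed.

HB.instance Definition _ (R : fieldType) (n : nat) :=
  GRing.isLinear.Build R 'M[R]_n 'M[R]_n _ (@symm R n) (@symm_is_linear R n).

(* The antisymmetric matrices, i.e. A^T + A = 0. *)
Definition Skew (R : fieldType) (n : nat) : {vspace 'M[R]_n} :=
  lker (linfun (@trmx R n n \+ idfun)).

Lemma mem_Skew (R : fieldType) (n : nat) (A : 'M[R]_n) :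
  (A \in Skew R n) = (A^T == - A).
Proof. by rewrite memv_ker lfunE /= addr_eq0. Qed.

Record task (R : realType) (n : nat) := Task {
  task_in : 'cV[R]_n;
  task_out : 'cV[R]_n;
  task_target : R }.

Definition taskM (R : realType) (n J : nat) (L : 'I_J -> task R n) (j : 'I_J) :
  'M[R]_n := task_out (L j) *m (task_in (L j))^T.

Definition yval (R : realType) (n J : nat) (L : 'I_J -> task R n)
  (X : 'M[R]_n) : 'rV[R]_J :=
  \row_j ((task_out (L j))^T *m X *m task_in (L j)) 0 0.

Lemma yval_mxdot (R : realType) (n J : nat) (L : 'I_J -> task R n)
  (X : 'M[R]_n) (j : 'I_J) : yval L X 0 j = mxdot (taskM L j) X.
Proof.
by rewrite mxE /mxdot /taskM trmx_mul trmxK -[in RHS]mulmxA mxtrace_mulC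
  trace_mx11.
Qed.

Definition Mspan (R : realType) (n J : nat) (L : 'I_J -> task R n) :
  {vspace 'M[R]_n} := <<codom (taskM L)>>%VS.

Definition Mspan_sym (R : realType) (n J : nat) (L : 'I_J -> task R n) :
  {vspace 'M[R]_n} := <<codom (fun j => symm (taskM L j))>>%VS.

(* An integer, so that the subtraction is not truncated. *)
Definition deficit (R : realType) (n J : nat) (L : 'I_J -> task R n) : int :=
  (\dim (Mspan L))%:Z - (\dim (Mspan_sym L))%:Z.

Definition Mcomb (R : realType) (n J : nat) (L : 'I_J -> task R n)
  (l : 'rV[R]_J) : 'M[R]_n := \sum_j l 0 j *: taskM L j.

Lemma Mcomb_is_linear (R : realType) (n J : nat) (L : 'I_J -> task R n) :
  linear (Mcomb L).
Proof.
move=> a u v; rewrite /Mcomb scaler_sumr -big_split /=; apply: eq_bigr => j _.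
by rewrite !mxE scalerDl scalerA.
Qed.

HB.instance Definition _ (R : realType) (n J : nat) (L : 'I_J -> task R n) :=
  GRing.isLinear.Build R 'rV[R]_J 'M[R]_n _ (Mcomb L) (Mcomb_is_linear L).

Definition Arel0 (R : realType) (n J : nat) (L : 'I_J -> task R n) :
  {vspace 'rV[R]_J} := lker (linfun (Mcomb L)).

Lemma mem_Arel0 (R : realType) (n J : nat) (L : 'I_J -> task R n)
  (l : 'rV[R]_J) : (l \in Arel0 L) = (Mcomb L l == 0).
Proof. by rewrite memv_ker lfunE. Qed.

Definition Arel (R : realType) (n J : nat) (L : 'I_J -> task R n) :
  {vspace 'rV[R]_J} := lker (linfun (@symm R n \o Mcomb L)).

Lemma mem_Arel (R : realType) (n J : nat) (L : 'I_J -> task R n)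
  (l : 'rV[R]_J) : (l \in Arel L) = (symm (Mcomb L l) == 0).
Proof. by rewrite memv_ker lfunE. Qed.

Definition Arel1 (R : realType) (n J : nat) (L : 'I_J -> task R n) :
  {vspace 'rV[R]_J} := (Arel L :&: orthc (Arel0 L))%VS.

Definition Sspace (R : realType) (n J : nat) (L : 'I_J -> task R n) :
  {vspace 'rV[R]_J} := orthc (Arel L).

Definition posdef (R : realType) (n : nat) (C : 'M[R]_n) : Prop :=
  C = C^T /\ forall v : 'cV[R]_n, v != 0 -> 0 < (v^T *m C *m v) 0 0.

Definition yval_symunit (R : realType) (n J : nat) (L : 'I_J -> task R n) :
  set 'rV[R]_J := yval L @` [set C | C = C^T /\ C \in unitmx].

Definition yval_posdef (R : realType) (n J : nat) (L : 'I_J -> task R n) :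
  set 'rV[R]_J := yval L @` [set C | posdef C].

(* In the library's subspace topology the points outside S are isolated, hence
   the inclusion. *)
Definition open_in (T : topologicalType) (S A : set T) : Prop :=
  A `<=` S /\ open (A : set (subspace S)).

Definition dense_in (T : topologicalType) (S A : set T) : Prop :=
  A `<=` S /\ S `<=` closure A.

(* Scaling by positive factors only: 0 need not belong to the cone. *)
Definition convex_cone (R : realType) (V : lmodType R) (A : set V) : Prop :=
  convex_set (A : set (convex_lmodType V)) /\
  forall (t : R) (v : V), 0 < t -> A v -> A (t *: v).

(* The span of an arbitrary set, as the least subspace containing it. *)
Definition spans (R : fieldType) (V : vectType R) (A : set V)
  (U : {vspace V}) : Prop :=
  A `<=` [set` U] /\
  forall W : {vspace V}, A `<=` [set` W] -> (U <= W)%VS.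

Definition rot90 (R : realType) (v : 'rV[R]_2) : 'rV[R]_2 :=
  \row_c (if c == 0 then - v 0 1 else v 0 0).

Definition length2 (R : realType) (v : 'rV[R]_2) : R :=
  Num.sqrt (v 0 0 ^+ 2 + v 0 1 ^+ 2).

(* R^{2N} is 'rV_(N * 2): the degree of freedom of node i along axis c has
   index mxvec_index i c. *)
Definition rigid_mode (R : realType) (N : nat) (x : 'I_N -> 'rV[R]_2)
  (v : 'rV[R]_2) (w : R) : 'rV[R]_(N * 2) :=
  mxvec (\matrix_(i < N) (v + w *: rot90 (x i))).

(* fdof enumerates the n = 2N - 3 free degrees of freedom; those outside its
   image are pinned. *)
Record network (R : realType) (N nb n : nat) := Network {
  node : 'I_N -> 'rV[R]_2;
  bond : 'I_nb -> 'I_N * 'I_N;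
  fdof : 'I_n -> 'I_(N * 2);
  bond_gt0 : forall b, 0 < length2 (node (bond b).2 - node (bond b).1);
  fdof_inj : injective fdof;
  fdof_count : (n + 3 = 2 * N)%N;
  pinned_rigid : forall (v : 'rV[R]_2) (w : R),
    (forall d, d \notin codom fdof -> rigid_mode node v w 0 d = 0) ->
    rigid_mode node v w = 0 }.

Section Stiffness.
Context {R : realType} {N nb n : nat} (W : network R N nb n).

Definition bond_normal (b : 'I_nb) : 'rV[R]_2 :=
  let d := node W (bond W b).2 - node W (bond W b).1 in (length2 d)^-1 *: d.

Definition bond_tangent (b : 'I_nb) : 'rV[R]_2 := rot90 (bond_normal b).

Definition bond_vec (b : 'I_nb) (u : 'rV[R]_2) : 'cV[R]_(N * 2) :=
  (mxvec (\matrix_(i < N) (((i == (bond W b).2)%:R - (i == (bond W b).1)%:R)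
                            *: u)))^T.

Definition bond_q (b : 'I_nb) := bond_vec b (bond_normal b).

Definition bond_s (b : 'I_nb) := bond_vec b (bond_tangent b).

Definition stiffness (k a : 'rV[R]_nb) : 'M[R]_(N * 2) :=
  \sum_b (k 0 b *: bond_q b + a 0 b *: bond_s b) *m (bond_q b)^T.

Definition Kff (k a : 'rV[R]_nb) : 'M[R]_n :=
  mxsub (fdof W) (fdof W) (stiffness k a).

Definition admissible (k a : 'rV[R]_nb) : Prop :=
  (forall b, 0 < k 0 b) /\ Kff k a \in unitmx.

End Stiffness.

(* Main.v *)
(** The map [l |-> M(l)] is adjoint to [X |-> y(X)], and [l |-> sym M(l)] to
    [X |-> y(sym X)], so (i)-(iii) are instances of the fact that the image
    of a linear map is the orthogonal complement of the kernel of its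
    adjoint, plus rank-nullity for [sym] on the span of the [M_j]. For (iv),
    a linear section of [y] on [S] with symmetric values transports openness
    in the symmetric matrices to openness in [S]; density and spanning come
    from the perturbations [X + t I], with [t] small respectively large. For
    (v), [y] takes its values in a fixed subspace, so its differential does
    too: at fixed [a] the antisymmetric part of [K_ff] does not depend on
    [k], hence [y(k')] lies in [S] for all [k'] once [K_ff(k)] is symmetric. *)

From HB Require Import structures.
Require Import Defs.
From mathcomp Require Import all_boot all_order all_algebra.
From mathcomp Require Import all_classical all_reals all_analysis.
From mathcomp Require Import lra.
Import Order.TTheory GRing.Theory Num.Theory.
Import numFieldNormedType.Exports.
Local Open Scope classical_set_scope.
Local Open Scope ring_scope.

(** * Orthogonal complements and adjoints *)

Lemma mxdotC (R : fieldType) (m n : nat) (A B : 'M[R]_(m, n)) :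
  mxdot A B = mxdot B A.
Proof. by rewrite /mxdot -mxtrace_tr trmx_mul trmxK. Qed.

Lemma mxdot_eq0 (R : realFieldType) (m n : nat) (A : 'M[R]_(m, n)) :
  (mxdot A A == 0) = (A == 0).
Proof.
apply/idP/eqP => [|->]; last by rewrite linear0r eqxx.
have pos i j : 0 <= A i j * A i j by rewrite -expr2 sqr_ge0.
rewrite mxdotE psumr_eq0 => [/allP A0|i _]; last by rewrite sumr_ge0.
apply/matrixP => i j; rewrite mxE; have := A0 i (mem_index_enum _).
rewrite psumr_eq0 //= => /allP /(_ j (mem_index_enum _)) /=.
by rewrite mulf_eq0 orbb => /eqP.
Qed.

Section LinearAlgebra.
Context {R : realFieldType}.

Lemma mem_orthc (n : nat) (U : {vspace 'rV[R]_n}) (u : 'rV[R]_n) :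
  u \in orthc U <-> forall v, v \in U -> mxdot u v = 0.
Proof. by split=> [/mem_orthovP|?]; last exact/mem_orthovP. Qed.

Lemma capv_orthc (n : nat) (U : {vspace 'rV[R]_n}) : (U :&: orthc U = 0)%VS.
Proof.
apply/eqP; rewrite -subv0; apply/subvP => u /memv_capP[uU /mem_orthc uU'].
by rewrite memv0 -mxdot_eq0 uU'.
Qed.

(** One inequality is disjointness from [U], where positivity of the form enters. The other is
    rank-nullity for the map that pairs a vector with a basis of [U]: its kernel lies in the
    complement and its codomain has dimension [\dim U]. *)
Lemma dim_orthc (n : nat) (U : {vspace 'rV[R]_n}) :
  (\dim U + \dim (orthc U))%N = n.
Proof.
have dimn : \dim {: 'rV[R]_n} = n by rewrite dimvf dim_matrix mul1r.
apply/eqP; rewrite eqn_leq; apply/andP; split.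
  rewrite -dimv_disjoint_sum ?capv_orthc//.
  by rewrite (leq_trans (dimvS (subvf _)))// dimn.
pose f (v : 'rV[R]_n) : 'rV[R]_(\dim U) := \row_i mxdot v (vbasis U)`_i.
have lf : linear f.
  by move=> a u v; apply/rowP => i; rewrite !mxE linearPl.
pose F : {linear _ -> _} := HB.pack f (GRing.isLinear.Build _ _ _ _ _ lf).
have kF : (lker (linfun F) <= orthc U)%VS.
  apply/subvP => v; rewrite memv_ker lfunE /= => /eqP /rowP v0.
  apply/mem_orthc => w /coord_vbasis ->; rewrite linear_sumr big1 //= => i _.
  by rewrite linearZr_LR /=; have := v0 i; rewrite !mxE => ->; rewrite mulr0.
have := limg_ker_dim (linfun F) fullv; rewrite capfv dimn => {1}<-.
rewrite addnC leq_add ?dimvS// (leq_trans (dimvS (subvf _)))//.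
by rewrite dimvf dim_matrix mul1r.
Qed.

Lemma orthcK (n : nat) (U : {vspace 'rV[R]_n}) : orthc (orthc U) = U.
Proof.
apply/esym/eqP; rewrite eqEdim; apply/andP; split.
  by apply/subvP => u uU; apply/mem_orthc => v /mem_orthc vU; rewrite mxdotC vU.
by rewrite -(leq_add2l (\dim (orthc U))) dim_orthc addnC dim_orthc.
Qed.

Lemma orthcS (n : nat) (U V : {vspace 'rV[R]_n}) :
  (U <= V)%VS -> (orthc V <= orthc U)%VS.
Proof.
move=> /subvP UV; apply/subvP => u /mem_orthc uV.
by apply/mem_orthc => v /UV /uV.
Qed.

Section Adjoint.
Context {J m n : nat} (A : 'Hom('rV[R]_J, 'M[R]_(m, n))).
Context (B : 'Hom('M[R]_(m, n), 'rV[R]_J)).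
Hypothesis adjAB : forall l X, mxdot l (B X) = mxdot (A l) X.

(** A vector [l] is orthogonal to the image of [B] exactly when [A l] is orthogonal to every [X],
    and testing at [X = A l] forces [A l = 0]. Thus the complement of the image is the kernel, and
    [orthcK] takes complements once more. *)
Lemma limg_adjoint : limg B = orthc (lker A).
Proof.
rewrite -[LHS]orthcK; congr orthc; apply/vspaceP => l; apply/idP/idP.
  move/mem_orthc => lB; rewrite memv_ker -mxdot_eq0 -adjAB.
  by rewrite lB ?memv_img ?memvf.
rewrite memv_ker => /eqP l0; apply/mem_orthc => _ /memv_imgP[X _ ->].
by rewrite adjAB l0 linear0l.
Qed.

Lemma dim_orthc_lker : \dim (orthc (lker A)) = \dim (limg A).
Proof.
apply/eqP; rewrite -(eqn_add2l (\dim (lker A))) dim_orthc.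
by rewrite -[in eqbRHS](capfv (lker A)) limg_ker_dim dimvf dim_matrix mul1r.
Qed.

End Adjoint.
End LinearAlgebra.

(** * Attainable values, their linear relations and the deficit *)

Section Responses.
Context {R : realType} {n J : nat} (L : 'I_J -> task R n).

Lemma yval_is_linear : linear (yval L).
Proof.
move=> a X Y; apply/rowP => j; rewrite yval_mxdot linearPr /=.
by rewrite -!yval_mxdot [RHS]mxE [X in _ = X + _]mxE.
Qed.

HB.instance Definition _ :=
  GRing.isLinear.Build R 'M[R]_n 'rV[R]_J _ (yval L) yval_is_linear.

Lemma mxdot_yval (l : 'rV[R]_J) (X : 'M[R]_n) :
  mxdot l (yval L X) = mxdot (Mcomb L l) X.
Proof.
rewrite mxdot_rV linear_sumlz; apply: eq_bigr => j _.
by rewrite linearZl_LR yval_mxdot.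
Qed.

Lemma symmE (X : 'M[R]_n) : X = X^T -> symm X = X.
Proof.
rewrite /symm => <-; rewrite -mulr2n -[X *+ 2]scaler_nat scalerA.
by rewrite mulVf ?scale1r.
Qed.

Lemma trmx_symm (X : 'M[R]_n) : symm X = (symm X)^T.
Proof. rewrite /symm [RHS]linearZ /=; congr (_ *: _).
by rewrite [RHS]linearD /= trmxK addrC. Qed.

Lemma mxdot_symm (X Y : 'M[R]_n) : mxdot (symm X) Y = mxdot X (symm Y).
Proof.
rewrite /symm linearZl_LR linearZr_LR /=; congr (_ * _).
rewrite linearDl linearDr /=; congr (_ + _).
by rewrite /mxdot trmxK -[in RHS]mxtrace_tr trmx_mul !trmxK mxtrace_mulC.
Qed.

Definition yvalf : 'Hom('M[R]_n, 'rV[R]_J) := linfun (yval L).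
(** Precomposing with [symm] turns the values on symmetric matrices into the image of a linear map
    on all matrices, so that [limg_adjoint] applies. *)
Definition ysymf : 'Hom('M[R]_n, 'rV[R]_J) := linfun (yval L \o @symm R n).

Lemma limg_yvalf : limg yvalf = orthc (Arel0 L).
Proof. by apply: limg_adjoint => l X; rewrite !lfunE /= mxdot_yval. Qed.

Lemma limg_ysymf : limg ysymf = Sspace L.
Proof.
by apply: limg_adjoint => l X; rewrite !lfunE /= mxdot_yval mxdot_symm.
Qed.

Lemma range_yval : range (yval L) = [set` orthc (Arel0 L)].
Proof.
rewrite -limg_yvalf; apply/seteqP; split=> [_ [X _ <-]|v /=].
  by apply/memv_imgP; exists X; rewrite ?memvf ?lfunE.
by move=> /memv_imgP[X _ ->]; exists X; rewrite ?lfunE.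
Qed.

Lemma range_yval_sym : yval L @` [set X | X = X^T] = [set` Sspace L].
Proof.
rewrite -limg_ysymf; apply/seteqP; split=> [_ [X /= Xs <-]|v /=].
  by apply/memv_imgP; exists X; rewrite ?memvf ?lfunE //= symmE.
by move=> /memv_imgP[X _ ->]; exists (symm X); rewrite ?lfunE //= -trmx_symm.
Qed.

Lemma limg_Mcomb : limg (linfun (Mcomb L)) = Mspan L.
Proof.
apply/eqP; rewrite eqEsubv; apply/andP; split; apply/subvP.
  move=> _ /memv_imgP[l _ ->]; rewrite lfunE /=; apply: memv_suml => j _.
  by rewrite memvZ// memv_span// codom_f.
apply/subvP/span_subvP => _ /codomP[j ->]; apply/memv_imgP.
exists (delta_mx 0 j); rewrite ?memvf// lfunE /= /Mcomb (bigD1 j)//= big1.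
  by rewrite mxE !eqxx scale1r addr0.
by move=> i /negPf ij; rewrite mxE ij andbF scale0r.
Qed.

Lemma limg_symm_Mspan : (linfun (@symm R n) @: Mspan L)%VS = Mspan_sym L.
Proof.
rewrite limg_span -map_comp; congr (<<_>>)%VS.
by apply: eq_map => j /=; rewrite lfunE.
Qed.

Lemma lker_symm : lker (linfun (@symm R n)) = Skew R n.
Proof.
apply/vspaceP => X; rewrite mem_Skew memv_ker lfunE /= scaler_eq0.
by rewrite invr_eq0 pnatr_eq0 /= addrC addr_eq0.
Qed.

Lemma dim_orthc_Arel0 : \dim (orthc (Arel0 L)) = \dim (Mspan L).
Proof. by rewrite dim_orthc_lker limg_Mcomb. Qed.

Lemma dim_Sspace : \dim (Sspace L) = \dim (Mspan_sym L).
Proof.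
rewrite dim_orthc_lker -limg_symm_Mspan -limg_Mcomb -limg_comp.
by congr (\dim (_ @: _)); apply/lfunP => l; rewrite !lfunE /= !lfunE.
Qed.

(** Rank-nullity for [symm] restricted to [Mspan L]: its image there is [Mspan_sym L] and its kernel
    consists of the antisymmetric elements. *)
Lemma deficit_Skew : deficit L = (\dim (Mspan L :&: Skew R n))%:Z.
Proof.
rewrite /deficit -limg_symm_Mspan -lker_symm.
by rewrite -(limg_ker_dim (linfun (@symm R n)) (Mspan L)) PoszD addrK.
Qed.

Lemma Arel0_sub : (Arel0 L <= Arel L)%VS.
Proof.
by apply/subvP => l; rewrite mem_Arel0 mem_Arel => /eqP ->; rewrite linear0.
Qed.

(** [Arel L] is the direct sum of [Arel0 L] and [Arel1 L]: since [Arel0 L] lies in [Arel L],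
    splitting a relation orthogonally along [Arel0 L] leaves both components in [Arel L]. *)
Lemma dim_Arel : \dim (Arel L) = (\dim (Arel0 L) + \dim (Arel1 L))%N.
Proof.
rewrite -dimv_disjoint_sum; last first.
  by apply/eqP; rewrite -subv0 -(capv_orthc _ (Arel0 L)) capvS// capvSr.
congr (\dim _); apply/eqP; rewrite eqEsubv subv_add Arel0_sub capvSl !andbT.
have full : (Arel0 L + orthc (Arel0 L) = fullv)%VS.
  apply/eqP; rewrite eqEdim subvf dimv_disjoint_sum ?capv_orthc//.
  by rewrite dim_orthc dimvf dim_matrix mul1r /=.
apply/subvP => l lA; have : l \in (Arel0 L + orthc (Arel0 L))%VS.
  by rewrite full memvf.
move=> /memv_addP[u uA [v vA lE]]; rewrite lE memv_add// memv_cap vA andbT.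
have -> : v = l - u by rewrite lE addrC addKr.
by rewrite rpredB// (subvP Arel0_sub).
Qed.

Lemma Sspace_sub : (Sspace L <= orthc (Arel0 L))%VS.
Proof. exact/orthcS/Arel0_sub. Qed.

Lemma dim_Arel1 :
  (\dim (orthc (Arel0 L)))%:Z - (\dim (Sspace L))%:Z = (\dim (Arel1 L))%:Z.
Proof.
suff -> : \dim (orthc (Arel0 L)) = (\dim (Arel1 L) + \dim (Sspace L))%N.
  by rewrite PoszD addrK.
apply/eqP; rewrite -(eqn_add2l (\dim (Arel0 L))) dim_orthc addnA -dim_Arel.
by rewrite dim_orthc.
Qed.

Lemma sum_yval_symP (l : 'rV[R]_J) :
  (forall X : 'M[R]_n, X = X^T -> \sum_j l 0 j * yval L X 0 j = 0) <->
  l \in Arel L.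
Proof.
rewrite mem_Arel; split=> [l0|/eqP l0 X Xs].
  (* The relation is tested on the symmetric part of [Mcomb L l] itself, where it says that the
     squared norm of that matrix vanishes. *)
  rewrite -mxdot_eq0 mxdot_symm -mxdot_yval mxdot_rV l0//.
  by rewrite [symm _]symmE -trmx_symm.
by rewrite -mxdot_rV mxdot_yval -[X]symmE// -mxdot_symm l0 linear0l.
Qed.

End Responses.

(** * Differentiability *)

Section Differentiability.
Context {R : realType} {V : normedModType R}.

(** The differential of [f] linearises [g] too, since only values near [x] matter. This is for
    [invmx], which agrees with its determinant formula only at invertible matrices. *)
Lemma near_eq_differentiable {W : normedModType R} (f g : V -> W) (x : V) :
  (\forall y \near x, f y = g y) -> differentiable f x -> differentiable g x.
Proof.
move=> fg /diff_locallyP[dfc dfx].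
have dgx : g \o shift x = cst (g x) + 'd f x +o_ 0 id.
  have fg0 : \forall h \near 0, f (h + x) = g (h + x).
    by move: fg; rewrite (near_shift 0 x) subr0.
  apply/eqaddoP => e e0; move/eqaddoP/(_ e e0): dfx; apply: filterS2 fg0 => h.
  by rewrite /= /shift !fctE /cst => ->; rewrite (nbhs_singleton fg).
by apply/diff_locallyP; rewrite (diff_unique dfc dgx).
Qed.

Lemma differentiable_big_sum {W : normedModType R} (I : Type) (r : seq I)
    (P : pred I) (F : I -> V -> W) (x : V) :
  (forall i, P i -> differentiable (F i) x) ->
  differentiable (fun y => \sum_(i <- r | P i) F i y) x.
Proof.
move=> dF; rewrite -fct_sumE.
by elim/big_ind : _ => // f g; exact: differentiableD.
Qed.

Lemma differentiable_big_prod (I : Type) (r : seq I)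
    (P : pred I) (F : I -> V -> R) (x : V) :
  (forall i, P i -> differentiable (F i) x) ->
  differentiable (fun y => \prod_(i <- r | P i) F i y) x.
Proof.
move=> dF; rewrite -fct_prodE; elim/big_ind : _ => // f g.
exact: differentiableM.
Qed.

Lemma differentiable_mx (m n : nat) (F : V -> 'M[R]_(m, n)) (x : V) :
  (forall i j, differentiable (fun y => F y i j) x) -> differentiable F x.
Proof.
move=> dF; have -> : F = fun y => \sum_i \sum_j F y i j *: delta_mx i j.
  by apply/funext => y; exact: matrix_sum_delta.
by do 2![apply: differentiable_big_sum => ? _]; exact: differentiableZl.
Qed.

Lemma differentiable_det (n : nat) (F : V -> 'M[R]_n) (x : V) :
  (forall i j, differentiable (fun y => F y i j) x) ->
  differentiable (fun y => \det (F y)) x.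
Proof.
move=> dF; apply: differentiable_big_sum => s _.
apply: (@differentiableM _ _ (cst _) (fun y => _)).
  exact: differentiable_cst.
by apply: differentiable_big_prod.
Qed.

(** The determinant stays non-zero near [x], so the inverse is there the adjugate over the
    determinant. Each entry of the adjugate is a sign times a minor, hence differentiable. *)
Lemma differentiable_invmx (n : nat) (F : V -> 'M[R]_n) (x : V) :
  (forall i j, differentiable (fun y => F y i j) x) -> F x \in unitmx ->
  differentiable (fun y => invmx (F y)) x.
Proof.
move=> dF Fx; have ddet := differentiable_det _ _ _ dF.
have detx : \det (F x) != 0 by rewrite -unitfE -unitmxE.
apply: (@near_eq_differentiable _ (fun y => (\det (F y))^-1 *: \adj (F y))).
  near=> y; rewrite /invmx unitmxE unitfE ifT//; near: y.
  exact: cvgr_neq0 (differentiable_continuous ddet) detx.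
apply: differentiable_mx => i j.
rewrite [X in differentiable X _](_ : _ = fun y =>
    (\det (F y))^-1 * cofactor (F y) j i); last first.
  by apply/funext => y; rewrite !mxE.
apply: (@differentiableM _ _ (fun y => _) (fun y => _)).
  exact: differentiableV.
apply: (@differentiableM _ _ (cst _) (fun y => _)).
  exact: differentiable_cst.
apply: differentiable_det => k l.
rewrite [X in differentiable X _](_ : _ = fun y =>
    F y (lift j k) (lift i l)); first exact: dF.
by apply/funext => y; rewrite !mxE.
Unshelve. all: by end_near. Qed.

End Differentiability.

(** * Continuity of linear maps on matrices *)

Section Linear.
Context {R : realType} {V : normedModType R} {m n : nat}.

Lemma continuous_linear_mx (f : {linear 'M[R]_(m, n) -> V}) : continuous f.
Proof.
move=> X; apply: differentiable_continuous.
have -> : f = (fun Y : 'M[R]_(m, n) =>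
    \sum_i \sum_j Y i j *: f (delta_mx i j)) :> (_ -> _).
  apply/funext => Y; rewrite {1}[Y]matrix_sum_delta linear_sum.
  apply: eq_bigr => i _; rewrite linear_sum.
  by apply: eq_bigr => j _; rewrite linearZ.
do 2![apply: differentiable_big_sum => ? _]; apply: differentiableZl.
exact: differentiable_coord.
Qed.

End Linear.

(** * Rank of the Jacobian of a map into a fixed subspace *)

Section Jacobian.
Context {R : realType}.

(** [U] is cut out by the functionals [mxdot l] with [l] in [orthc U]. Each of them composed with
    [f] is constantly zero, so by the chain rule it kills the differential. *)
Lemma diff_mem (J : nat) (V : normedModType R) (f : V -> 'rV[R]_J)
    (U : {vspace 'rV[R]_J}) (x v : V) :
  (forall y, f y \in U) -> differentiable f x -> 'd f x v \in U.
Proof.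
move=> fU df; rewrite -[U]orthcK; apply/mem_orthc => l lU.
rewrite mxdotC; have lg : linear (mxdot l : 'rV[R]_J -> R).
  by move=> a u w; rewrite linearPr.
pose g : {linear 'rV[R]_J -> R} :=
  HB.pack (mxdot l) (GRing.isLinear.Build _ _ _ _ _ lg).
have gc : continuous g by exact: continuous_linear_mx.
have dg y : differentiable g y by exact: linear_differentiable.
have := diff_comp df (dg _); rewrite diff_lin// => /(congr1 (@^~ v)) /= <-.
have -> : g \o f = cst 0.
  apply/funext => y; rewrite /=; move/mem_orthc: lU; apply; exact: fU.
by rewrite diff_cst.
Qed.

Lemma mxrank_rows_in_vspace (m J : nat) (M : 'M[R]_(m, J))
    (U : {vspace 'rV[R]_J}) :
  (forall i, row i M \in U) -> (\rank M <= \dim U)%N.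
Proof.
move=> MU; pose B : 'M[R]_(\dim U, J) := \matrix_(i < \dim U) (vbasis U)`_i.
pose K : 'M[R]_(m, \dim U) := \matrix_(i, j) coord (vbasis U) j (row i M).
(* Writing the rows in a basis of [U] factors [M] through dimension [\dim U]. *)
suff -> : M = K *m B by rewrite (leq_trans (mxrankM_maxr _ _))// rank_leq_row.
apply/row_matrixP => i; rewrite row_mul {1}(coord_vbasis (MU i)) mulmx_sum_row.
by apply: eq_bigr => j _; rewrite !mxE rowK.
Qed.

Lemma rank_jacobian (m J : nat) (f : 'rV[R]_m -> 'rV[R]_J)
    (U : {vspace 'rV[R]_J}) (x : 'rV[R]_m) :
  (forall y, f y \in U) -> differentiable f x -> (\rank ('J f x) <= \dim U)%N.
Proof.
move=> fU df; apply: mxrank_rows_in_vspace => i.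
by rewrite rowE mul_rV_lin1; exact: diff_mem.
Qed.

End Jacobian.

(** * Positive definite matrices *)

Section PositiveDefinite.
Context {R : realType} {n : nat}.
Implicit Types (A B C X : 'M[R]_n) (v w : 'cV[R]_n).

Lemma ler_mx_norm_entry m p (A : 'M[R]_(m, p)) i j : `|A i j| <= `|A|.
Proof.
rewrite [leRHS]mx_normrE.
exact: (le_bigmax _ (fun ij : 'I_m * 'I_p => `|A ij.1 ij.2|) (i, j)).
Qed.

Lemma quadformE A v : (v^T *m A *m v) 0 0 = mxdot v (A *m v).
Proof. by rewrite /mxdot mulmxA trace_mx11. Qed.

Lemma mxdot_ge0 v : 0 <= mxdot v v.
Proof.
rewrite mxdotE !sumr_ge0// => i _; rewrite sumr_ge0// => j _.
by rewrite -expr2 sqr_ge0.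
Qed.

Lemma mxdot_gt0 v : v != 0 -> 0 < mxdot v v.
Proof. by move=> v0; rewrite lt_neqAle mxdot_ge0 eq_sym mxdot_eq0 v0. Qed.

Lemma mxdot_adj A v w : mxdot v (A *m w) = mxdot (A^T *m v) w.
Proof. by rewrite /mxdot trmx_mul trmxK mulmxA. Qed.

(** The norm of a matrix is its largest absolute entry, so each of the [n * n] terms of the form is
    at most this norm times [mxdot v v]. *)
Lemma norm_quadform_le A v :
  `|mxdot v (A *m v)| <= (n * n)%:R * `|A| * mxdot v v.
Proof.
have entry i : `|v i 0| ^+ 2 <= mxdot v v.
  rewrite real_normK ?num_real// mxdotE (bigD1 i)//= big_ord1 -expr2 lerDl.
  rewrite sumr_ge0// => j _.
  by rewrite big_ord1 -expr2 sqr_ge0.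
have vij i j : `|v i 0| * `|v j 0| <= mxdot v v.
  (* Twice the product is at most the sum of the two squares, each bounded by [mxdot v v]. *)
  have := sqr_ge0 (`|v i 0| - `|v j 0|).
  have := entry i; have := entry j.
  set a := `|v i 0|; set b := `|v j 0|; set q := mxdot v v; lra.
rewrite mxdotE (le_trans (ler_norm_sum _ _ _))//.
have -> : (n * n)%:R * `|A| * mxdot v v =
    \sum_(i < n) \sum_(j < n) `|A| * mxdot v v.
  by rewrite !sumr_const !card_ord -mulrnA -mulrA mulr_natl.
apply: ler_sum => i _; rewrite big_ord1 mxE mulr_sumr.
rewrite (le_trans (ler_norm_sum _ _ _))//; apply: ler_sum => j _.
rewrite !normrM mulrCA ler_pM// ?ler_mx_norm_entry// mulr_ge0//.
Qed.

Lemma posdefE C : posdef C <->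
  C = C^T /\ forall v, v != 0 -> 0 < mxdot v (C *m v).
Proof.
by split=> -[Cs Cp]; split=> // v v0; have := Cp v v0; rewrite quadformE.
Qed.

Lemma posdef_unitmx C : posdef C -> C \in unitmx.
Proof.
move=> [Cs Cp]; rewrite unitmxE unitfE; apply/det0P => -[v v0 vC].
have := Cp v^T; rewrite trmxK vC mul0mx mxE ltxx => vT.
apply/negP: v0; rewrite negbK -(inj_eq trmx_inj) trmx0.
by apply: contraT => /vT.
Qed.

(* Expanding the form at [v - t C^-1 v] and choosing [t] small gives coercivity
   without any compactness argument. *)
Lemma posdef_coercive C : posdef C ->
  exists2 e : R, 0 < e & forall v, e * mxdot v v <= mxdot v (C *m v).
Proof.
move=> /[dup] /posdef_unitmx Cu /posdefE[Cs Cp].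
(* [b] bounds the form of [invmx C], and the [+ 1] makes it positive. With [t = b^-1] the term of
   order [t ^+ 2] is at most [t * mxdot v v], half of what the linear term subtracts, which leaves
   [t] as the coercivity constant. *)
pose b := (n * n)%:R * `|invmx C| + 1 : R.
have b0 : 0 < b by rewrite ltr_wpDl// mulr_ge0.
exists b^-1; rewrite ?invr_gt0// => v.
pose u := invmx C *m v; pose w := v - b^-1 *: u.
have w_ge0 : 0 <= mxdot w (C *m w).
  by have [->|/Cp/ltW//] := eqVneq w 0; rewrite mulmx0 linear0r.
have Cw : C *m w = C *m v - b^-1 *: v.
  by rewrite mulmxBr -scalemxAr mulKVmx.
have uCv : mxdot u (C *m v) = mxdot v v by rewrite mxdot_adj -Cs mulKVmx.
have uv : mxdot u v <= b * mxdot v v.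
  rewrite mxdotC (le_trans (ler_norm _))// (le_trans (norm_quadform_le _ _))//.
  by rewrite ler_wpM2r ?mxdot_ge0// lerDl.
move: w_ge0; rewrite Cw /w linearBl !linearBr /= !(linearZl_LR, linearZr_LR) /=.
rewrite uCv => w_ge0.
have : b^-1 * (b^-1 * mxdot u v) <= b^-1 * mxdot v v.
  rewrite ler_pM2l ?invr_gt0//; rewrite -(ler_pM2l b0) mulrA divff ?mul1r//.
  exact: lt0r_neq0.
lra.
Qed.

Lemma near_posdef C : posdef C -> \forall X \near C, X = X^T -> posdef X.
Proof.
move=> /posdef_coercive[e e0 Ce].
have N0 : 0 < (n * n)%:R + 1 :> R by rewrite ltr_wpDl.
near=> X; move=> Xs; apply/posdefE; split=> // v v0.
have v_gt0 := mxdot_gt0 _ v0.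
(* With this radius the form of [X - C] stays below the coercivity bound [e * mxdot v v]; the [+ 1]
   keeps the denominator positive even for [n = 0]. *)
have XC : `|X - C| < e / ((n * n)%:R + 1).
  near: X; apply: cvgr_distC_lt => //; rewrite divr_gt0//.
have -> : X = C + (X - C) by rewrite addrC subrK.
rewrite mulmxDl linearDr /=.
have := norm_quadform_le (X - C) v; have := Ce v.
rewrite ler_norml => Cv /andP[+ _].
suff : (n * n)%:R * `|X - C| * mxdot v v < e * mxdot v v by lra.
rewrite ltr_pM2r// (le_lt_trans (y := ((n * n)%:R + 1) * `|X - C|))//.
  by rewrite ler_wpM2r// lerDl.
by rewrite mulrC -ltr_pdivlMr.
Unshelve. all: by end_near. Qed.

Lemma near_unitmx C : C \in unitmx -> \forall X \near C, X \in unitmx.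
Proof.
rewrite unitmxE unitfE => detC; near=> X; rewrite unitmxE unitfE; near: X.
apply: cvgr_neq0 detC; apply: differentiable_continuous.
apply: differentiable_det => i j; exact: differentiable_coord.
Unshelve. all: by end_near. Qed.

Lemma posdef_lincomb (a b : R) A B : 0 < a -> 0 < b -> posdef A -> posdef B ->
  posdef (a *: A + b *: B).
Proof.
move=> a0 b0 /posdefE[As Ap] /posdefE[Bs Bp]; apply/posdefE; split.
  by rewrite linearD /= !linearZ /= -As -Bs.
move=> v v0; rewrite mulmxDl -!scalemxAl linearDr /= !linearZr_LR /=.
by rewrite addr_gt0// mulr_gt0// ?Ap// ?Bp.
Qed.

Lemma posdef_scale (a : R) A : 0 < a -> posdef A -> posdef (a *: A).
Proof.
move=> a0 A0; have -> : a *: A = (a / 2) *: A + (a / 2) *: A.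
  by rewrite -scalerDl; congr (_ *: _); lra.
by apply: posdef_lincomb => //; lra.
Qed.

Lemma posdef_shift X : X = X^T ->
  exists2 t : R, 0 < t & posdef (X + t%:M).
Proof.
move=> Xs; exists ((n * n)%:R * `|X| + 1); first by rewrite ltr_wpDl// mulr_ge0.
apply/posdefE; split; first by rewrite linearD /= tr_scalar_mx -Xs.
move=> v v0; have v_gt0 := mxdot_gt0 _ v0.
rewrite mulmxDl mul_scalar_mx linearDr /= linearZr_LR /=.
by have := norm_quadform_le X v; rewrite ler_norml => /andP[+ _]; lra.
Qed.

Lemma posdef_scalar (t : R) : 0 < t -> posdef (t%:M : 'M[R]_n).
Proof.
move=> t0; apply/posdefE; split=> [|v v0]; first by rewrite tr_scalar_mx.
by rewrite mul_scalar_mx linearZr_LR mulr_gt0// mxdot_gt0.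
Qed.

(** The determinant of [X + t%:M] is the characteristic polynomial of [- X] at [t]. Being monic it
    is non-zero, so a power of the variable can be split off, leaving a factor [q] with [q.[0] !=
    0]; neither factor vanishes for small positive [t]. *)
Lemma near_unitmx_shift X : \forall t \near 0^'+, X + t%:M \in unitmx.
Proof.
pose p := char_poly (- X).
have [m [q]] := multiplicity_XsubC p 0; rewrite monic_neq0 ?char_poly_monic//=.
rewrite /root => q0 pq; near=> t.
have -> : X + t%:M = t%:M - (- X) by rewrite opprK addrC.
have t0 : t != 0 by rewrite lt0r_neq0.
have -> : (t%:M - - X \in unitmx) = (p.[t] != 0).
  rewrite unitmxE unitfE /p /char_poly -horner_evalE -det_map_mx.
  congr (\det _ != 0); apply/matrixP => i j.
  by rewrite !mxE /= horner_evalE !hornerE hornerMn hornerX.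
rewrite pq hornerM horner_exp !hornerE subr0 mulf_neq0 ?expf_neq0//; near: t.
apply: cvgr_neq0 q0; apply: cvg_at_right_filter; exact: continuous_horner.
Unshelve. all: by end_near. Qed.

End PositiveDefinite.

(** * Values of symmetric responses *)

(** At a point of [S] the neighbourhoods of the subspace topology are given by those of [T]
    restricted to [S], and [A] has no other points. *)
Lemma near_open_in (T : topologicalType) (S A : set T) : A `<=` S ->
  (forall x, A x -> \forall y \near x, S y -> A y) -> open_in S A.
Proof.
move=> AS nA; have wA (x : T) : A x -> @nbhs_subspace T S x A.
  by move=> Ax; rewrite -nbhs_subspace_in; [exact: nA|exact: AS].
by split=> //; rewrite openE => x /wA.
Qed.

Lemma cvg_linear_shift (R : realType) (m n : nat) (V : normedModType R)
    (f : {linear 'M[R]_(m, n) -> V}) (c : V) (X : 'M[R]_(m, n)) :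
  (fun Y : 'M[R]_(m, n) => c + f (Y - X)) @ X --> c.
Proof.
have cB : (fun Y : 'M[R]_(m, n) => Y - X) @ X --> X - X.
  exact: (cvgB cvg_id (cvg_cst X)).
have cf : (fun Y : 'M[R]_(m, n) => f (Y - X)) @ X --> f (X - X).
  exact: (cvg_comp _ _ cB (continuous_linear_mx f (X - X))).
have fXX : c + f (X - X) = c by rewrite subrr linear0 addr0.
by rewrite -[Z in _ --> Z]fXX; exact: (cvgD (cvg_cst c) cf).
Qed.

Section SymmetricValues.
Context {R : realType} {n J : nat} (L : 'I_J -> task R n).

Lemma yval_sym_Sspace (C : 'M[R]_n) : C = C^T -> yval L C \in Sspace L.
Proof.
by move=> Cs; have /seteqP[+ _] := range_yval_sym L; apply; exists C.
Qed.

Lemma Sspace_yval v : v \in Sspace L -> exists2 X, X = X^T & yval L X = v.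
Proof.
by move=> vS; have /seteqP[_ /(_ v vS)[X]] := range_yval_sym L; exists X.
Qed.

(** The symmetric part of a linear right inverse of [ysymf L] on its image works, because [ysymf L]
    already symmetrises before evaluating. *)
Lemma yval_section : exists s : {linear 'rV[R]_J -> 'M[R]_n},
  (forall v, s v = (s v)^T) /\ {in Sspace L, cancel s (yval L)}.
Proof.
pose s (v : 'rV[R]_J) : 'M[R]_n := symm ((ysymf L)^-1%VF v).
have ls : linear s by move=> a u v; rewrite /s !linearP.
pose sL : {linear 'rV[R]_J -> 'M[R]_n} :=
  HB.pack s (GRing.isLinear.Build _ _ _ _ _ ls).
exists sL.
split=> v /=; first exact: trmx_symm.
by rewrite -limg_ysymf => /limg_lfunVK; rewrite lfunE.
Qed.

(** Around [v = yval L C], a nearby [w] in [Sspace L] is the value of [C + s (w - v)], a symmetric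
    matrix that tends to [C] as [w] tends to [v] and hence ends up in [P]. *)
Lemma open_in_yval (P : set 'M[R]_n) :
  (forall C, P C -> C = C^T /\ \forall X \near C, X = X^T -> P X) ->
  open_in [set` Sspace L] (yval L @` P).
Proof.
move=> PP; have [s [s_sym yvals]] := yval_section.
have sP (v : 'rV[R]_J) : (yval L @` P) v ->
    \forall w \near v, w \in Sspace L -> (yval L @` P) w.
  move=> [C PC Cv]; have [Cs nC] := PP C PC.
  have vS : v \in Sspace L by rewrite -Cv yval_sym_Sspace.
  have : \forall w \near v,
      C + s (w - v) = (C + s (w - v))^T -> P (C + s (w - v)).
    exact: cvg_linear_shift _ _ _ _ s C v _ nC.
  apply: filterS => w /= Pw wS.
  exists (C + s (w - v)); last first.
    by rewrite linearD /= yvals ?rpredB// Cv addrC subrK.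
  by apply: Pw; rewrite [RHS]linearD /= -s_sym -Cs.
apply: near_open_in => [_ [C /PP[Cs _] <-]|v Pv]; last exact: sP.
exact: yval_sym_Sspace.
Qed.

Lemma cvg_yval_shift (X : 'M[R]_n) :
  yval L (X + t%:M) @[t --> 0^'+] --> yval L X.
Proof.
apply: cvg_at_right_filter.
have -> : (fun t : R => yval L (X + t%:M)) =
    (fun t => yval L X + t *: yval L 1%:M).
  by apply/funext => t; rewrite linearD /= -linearZ /= scalemx1.
rewrite -[X in _ --> X]addr0 -[0 in X in _ --> X](scale0r (yval L 1%:M)).
by apply: cvgD; [exact: cvg_cst|apply: cvgZr_tmp; exact: cvg_id].
Qed.

Lemma open_in_yval_symunit : open_in [set` Sspace L] (yval_symunit L).
Proof.
apply: open_in_yval => C /= [Cs Cu]; split=> //.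
by have := near_unitmx C Cu; apply: filterS.
Qed.

Lemma open_in_yval_posdef : open_in [set` Sspace L] (yval_posdef L).
Proof.
apply: open_in_yval => C /= Cp; split; first by case: Cp.
exact: near_posdef.
Qed.

Lemma dense_in_yval_symunit : dense_in [set` Sspace L] (yval_symunit L).
Proof.
split; first by have [] := open_in_yval_symunit.
move=> v /Sspace_yval[X Xs <-].
apply: (@closed_cvg _ _ (0^'+) _ (fun t => yval L (X + t%:M))).
- exact: closed_closure.
- near=> t; apply: subset_closure; exists (X + t%:M) => //=; split.
    by rewrite linearD /= tr_scalar_mx -Xs.
  by near: t; exact: near_unitmx_shift.
- exact: cvg_yval_shift.
Unshelve. all: by end_near. Qed.

Lemma yval_posdef_nonempty : yval_posdef L !=set0.
Proof. by exists (yval L 1%:M); exists 1%:M => //=; exact: posdef_scalar. Qed.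

Lemma convex_cone_yval_posdef : convex_cone (yval_posdef L).
Proof.
split; last first.
  move=> t _ t0 [C /= Cp <-]; exists (t *: C); last by rewrite linearZ.
  exact: posdef_scale.
apply/convex_setW => _ _ /set_mem[A /= Ap <-] /set_mem[B /= Bp <-] k k0 k1.
apply/mem_set; exists (k%:num *: A + (1 - k%:num) *: B) => /=.
  by apply: posdef_lincomb => //; rewrite subr_gt0.
by rewrite linearD /= !linearZ.
Qed.

Lemma yval_posdef_symunit : yval_posdef L `<=` yval_symunit L.
Proof.
move=> _ [C /= Cp <-]; exists C => //=; split; last exact: posdef_unitmx.
by case: Cp.
Qed.

(** Every symmetric [X] is a difference of two positive definite matrices, [X + t%:M] and [t%:M]
    with [t] large. *)
Lemma Sspace_sub_posdef (W : {vspace 'rV[R]_J}) :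
  yval_posdef L `<=` [set` W] -> (Sspace L <= W)%VS.
Proof.
move=> PW; apply/subvP => _ /Sspace_yval[X Xs <-].
have [t t0 Xt] := posdef_shift X Xs.
rewrite -[X](addrK t%:M) linearB /= rpredB//.
  by apply: PW; exists (X + t%:M).
by apply: PW; exists t%:M => //; exact: posdef_scalar.
Qed.

Lemma spans_yval_posdef : spans (yval_posdef L) (Sspace L).
Proof.
split; first by have [] := open_in_yval_posdef.
exact: Sspace_sub_posdef.
Qed.

Lemma spans_yval_symunit : spans (yval_symunit L) (Sspace L).
Proof.
split; first by have [] := open_in_yval_symunit.
move=> W SW; apply: Sspace_sub_posdef.
exact: subset_trans yval_posdef_symunit SW.
Qed.

(** A relation [l] holds on [A] exactly when [A] lies in the subspace [orthc <[l]>], which then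
    contains the span. *)
Lemma spans_relation (A : set 'rV[R]_J) (U : {vspace 'rV[R]_J}) (l : 'rV[R]_J) :
  spans A U -> (forall v, A v -> \sum_j l 0 j * v 0 j = 0) ->
  forall v, v \in U -> \sum_j l 0 j * v 0 j = 0.
Proof.
move=> [_ AU] Al v vU; rewrite -mxdot_rV mxdotC.
have : v \in orthc <[l]>%VS.
  apply: (subvP (AU _ _)) vU => w /Al lw /=.
  apply/mem_orthc => _ /vlineP[c ->].
  by rewrite linearZr_LR /= mxdotC mxdot_rV lw mulr0.
by move/mem_orthc; apply; exact: memv_line.
Qed.

End SymmetricValues.

(** * A task list with proper, non-closed value sets *)

Section Example.
Context {R : realType}.

(** Here [y] is the identity on 1 by 1 matrices: 0 is a symmetric value and a limit of positive
    ones, but it is not the value of an invertible matrix. *)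
Definition unit_task : 'I_1 -> task R 1 := fun=> Task 1%:M 1%:M 0.

Lemma yval_unit_task (X : 'M[R]_1) : yval unit_task X = X.
Proof.
by apply/rowP => j; rewrite mxE /= trmx1 mul1mx mulmx1 !ord1.
Qed.

Lemma unit_task_symunit0 : ~ yval_symunit unit_task 0.
Proof.
move=> [X /= [_ Xu]]; rewrite yval_unit_task => X0.
by move: Xu; rewrite X0 unitr0.
Qed.

Lemma unit_task_posdef0 : ~ yval_posdef unit_task 0.
Proof. by move=> /yval_posdef_symunit; exact: unit_task_symunit0. Qed.

Lemma unit_task_proper :
  yval_symunit unit_task `<` [set` Sspace unit_task] /\
  yval_posdef unit_task `<` [set` Sspace unit_task].
Proof.
split; split=> [|S0].
- by have [] := open_in_yval_symunit unit_task.
- by apply/unit_task_symunit0/S0; exact: mem0v.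
- by have [] := open_in_yval_posdef unit_task.
- by apply/unit_task_posdef0/S0; exact: mem0v.
Qed.

Lemma unit_task_not_closed : ~ closed (yval_posdef unit_task).
Proof.
move=> Pcl; apply: unit_task_posdef0; rewrite -(linear0 (yval unit_task)).
apply: (@closed_cvg _ _ (0^'+) _ (fun t => yval unit_task (0 + t%:M))) => //.
  near=> t; exists (0 + t%:M) => //=; rewrite add0r; exact: posdef_scalar.
exact: cvg_yval_shift.
Unshelve. all: by end_near. Qed.

End Example.

(** * Dependence of the network stiffness on its parameters *)

Section Network.
Context {R : realType} {N nb n : nat} (W : network R N nb n).

(** Both parameters are functions on a common space [V], so that one statement serves for varying
    [k] at fixed [a] and for varying the pair. *)
Lemma differentiable_Kff {V : normedModType R} (k a : V -> 'rV[R]_nb) (x : V) :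
  (forall b, differentiable (fun y => k y 0 b) x) ->
  (forall b, differentiable (fun y => a y 0 b) x) ->
  forall i j, differentiable (fun y => Kff W (k y) (a y) i j) x.
Proof.
move=> dk da i j.
rewrite [X in differentiable X _](_ : _ = fun y => \sum_b
    (k y 0 b * bond_q W b (fdof W i) 0 + a y 0 b * bond_s W b (fdof W i) 0) *
      bond_q W b (fdof W j) 0).
  apply: differentiable_big_sum => b _.
  apply: (@differentiableM _ _ (fun y => _) (cst _)); last first.
    exact: differentiable_cst.
  apply: (@differentiableD _ _ _ (fun y => _) (fun y => _)).
    by apply: (@differentiableM _ _ (fun y => _) (cst _)); first exact: dk.
  by apply: (@differentiableM _ _ (fun y => _) (cst _)); first exact: da.
apply/funext => y; rewrite mxE summxE; apply: eq_bigr => b _.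
by rewrite mxE big_ord1 !mxE.
Qed.

(** Changing [k] adds a combination [D] of the symmetric rank-one matrices [q q^T], and restricting
    to the same rows and columns keeps it symmetric. *)
Lemma Kff_sym (k k' a : 'rV[R]_nb) :
  Kff W k a = (Kff W k a)^T -> Kff W k' a = (Kff W k' a)^T.
Proof.
pose D := \sum_b (k' 0 b - k 0 b) *: (bond_q W b *m (bond_q W b)^T).
have DT : D^T = D.
  rewrite /D linear_sum /=; apply: eq_bigr => b _.
  by rewrite linearZ /= trmx_mul trmxK.
have -> : Kff W k' a = Kff W k a + mxsub (fdof W) (fdof W) D.
  rewrite /Kff -linearD /=; congr mxsub; rewrite /stiffness /D -big_split /=.
  apply: eq_bigr => b _; rewrite !mulmxDl -!scalemxAl scalerBl.
  by rewrite [RHS]addrC addrA subrK.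
move=> Ks; rewrite linearD /= -Ks; congr (_ + _).
by rewrite trmx_mxsub DT.
Qed.

Lemma differentiable_yval_Kff {J : nat} (L : 'I_J -> task R n)
    {V : normedModType R} (k a : V -> 'rV[R]_nb) (x : V) :
  (forall b, differentiable (fun y => k y 0 b) x) ->
  (forall b, differentiable (fun y => a y 0 b) x) ->
  Kff W (k x) (a x) \in unitmx ->
  differentiable (fun y => yval L (invmx (Kff W (k y) (a y)))) x.
Proof.
move=> dk da Ku.
apply: (@differentiable_comp _ _ _ _
    (fun y => invmx (Kff W (k y) (a y))) (yval L)).
  by apply: differentiable_invmx => // i j; exact: differentiable_Kff.
by apply: linear_differentiable; exact: continuous_linear_mx.
Qed.

End Network.


Theorem proposition5 (R : realType) (n J : nat) (L : 'I_J -> task R n) :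
  (* (i) *)
  (range (yval L) = [set` orthc (Arel0 L)] /\
   \dim (orthc (Arel0 L)) = \dim (Mspan L)) /\
  (* (ii) *)
  (yval L @` [set X | X = X^T] = [set` Sspace L] /\
   \dim (Sspace L) = \dim (Mspan_sym L) /\
   (Sspace L <= orthc (Arel0 L))%VS /\
   (\dim (orthc (Arel0 L)))%:Z - (\dim (Sspace L))%:Z = (\dim (Arel1 L))%:Z /\
   (\dim (Arel1 L))%:Z = deficit L /\
   (forall C : 'M[R]_n, C = C^T -> yval L C \in Sspace L) /\
   (forall l : 'rV[R]_J,
      (forall X : 'M[R]_n, X = X^T -> \sum_j l 0 j * yval L X 0 j = 0) <->
      l \in Arel L)) /\
  (* (iii) *)
  deficit L = (\dim (Mspan L :&: Skew R n))%:Z /\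
  (* (iv) *)
  (open_in [set` Sspace L] (yval_symunit L) /\
   dense_in [set` Sspace L] (yval_symunit L) /\
   yval_posdef L !=set0 /\
   open_in [set` Sspace L] (yval_posdef L) /\
   convex_cone (yval_posdef L) /\
   (exists (n' J' : nat) (L' : 'I_J' -> task R n'),
      yval_symunit L' `<` [set` Sspace L'] /\
      yval_posdef L' `<` [set` Sspace L']) /\
   (exists (n' J' : nat) (L' : 'I_J' -> task R n'),
      ~ closed (yval_posdef L')) /\
   spans (yval_symunit L) (Sspace L) /\
   spans (yval_posdef L) (Sspace L) /\
   (forall l : 'rV[R]_J,
      (forall v, yval_symunit L v -> \sum_j l 0 j * v 0 j = 0) ->
      forall v, v \in Sspace L -> \sum_j l 0 j * v 0 j = 0) /\
   (forall l : 'rV[R]_J,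
      (forall v, yval_posdef L v -> \sum_j l 0 j * v 0 j = 0) ->
      forall v, v \in Sspace L -> \sum_j l 0 j * v 0 j = 0)) /\
  (* (v) *)
  (forall (N nb : nat) (W : network R N nb n) (k a : 'rV[R]_nb),
     admissible W k a ->
     (Kff W k a = (Kff W k a)^T ->
      let y_k (k' : 'rV[R]_nb) := yval L (invmx (Kff W k' a)) in
      differentiable y_k k /\
      (\rank ('J y_k k))%:Z <=
        Num.min nb%:Z ((\dim (Mspan L))%:Z - deficit L)) /\
     (let y_ka (p : 'rV[R]_(nb + nb)) :=
        yval L (invmx (Kff W (lsubmx p) (rsubmx p))) in
      differentiable y_ka (row_mx k a) /\
      (\rank ('J y_ka (row_mx k a)) <= minn (2 * nb) (\dim (Mspan L)))%N)).
Proof.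
split; first by split; [exact: range_yval|exact: dim_orthc_Arel0].
split.
  split; first exact: range_yval_sym.
  split; first exact: dim_Sspace.
  split; first exact: Sspace_sub.
  split; first exact: dim_Arel1.
  split; first by rewrite -dim_Arel1 dim_orthc_Arel0 dim_Sspace.
  by split; [exact: yval_sym_Sspace|exact: sum_yval_symP].
split; first exact: deficit_Skew.
split.
  split; first exact: open_in_yval_symunit.
  split; first exact: dense_in_yval_symunit.
  split; first exact: yval_posdef_nonempty.
  split; first exact: open_in_yval_posdef.
  split; first exact: convex_cone_yval_posdef.
  split; first by exists 1%N, 1%N, unit_task; exact: unit_task_proper.
  split; first by exists 1%N, 1%N, unit_task; exact: unit_task_not_closed.
  split; first exact: spans_yval_symunit.
  split; first exact: spans_yval_posdef.
  split=> l; apply: spans_relation.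
    exact: spans_yval_symunit.
  exact: spans_yval_posdef.
move=> N nb W k a [_ Ku]; split=> [Ks y_k|y_ka].
  have dy : differentiable y_k k.
    apply: (differentiable_yval_Kff W L id (cst a)) => // b.
      exact: differentiable_coord.
    exact: differentiable_cst.
  split=> //; rewrite le_min lez_nat rank_leq_row /=.
  (* Subtracting the deficit from [\dim (Mspan L)] leaves [\dim (Mspan_sym L)], the dimension of
     [Sspace L]. *)
  rewrite /deficit opprB addrCA subrr addr0 lez_nat -dim_Sspace.
  (* Membership is required at every [k'], including those with singular [Kff]. There [invmx]
     returns its argument, so [trmx_inv] still gives a symmetric matrix. *)
  apply: rank_jacobian dy => k'; apply: yval_sym_Sspace.
  by rewrite trmx_inv -(Kff_sym W k k' a Ks).
have dy : differentiable y_ka (row_mx k a).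
  apply: (differentiable_yval_Kff W L lsubmx rsubmx) => [b|b|].
  - rewrite [X in differentiable X _](_ : _ = fun p : 'rV[R]_(nb + nb) =>
      p 0 (lshift nb b)); first exact: differentiable_coord.
    by apply/funext => p; rewrite mxE.
  - rewrite [X in differentiable X _](_ : _ = fun p : 'rV[R]_(nb + nb) =>
      p 0 (rshift nb b)); first exact: differentiable_coord.
    by apply/funext => p; rewrite mxE.
  - by rewrite row_mxKl row_mxKr.
split=> //; rewrite leq_min mul2n -addnn rank_leq_row /= -dim_orthc_Arel0.
(* Without symmetry the values still lie in the range of [yval L], whatever matrix [invmx]
   returns. *)
apply: rank_jacobian dy => p.
have /seteqP[+ _] := range_yval L; apply.
by exists (invmx (Kff W (lsubmx p) (rsubmx p))).
Qed.
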